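(* Let $n\ge 5$ be an odd integer and let $k\ge 1$ be an integer. Then the $k$-inflated copy of the $L$ $n$-omino has a signed tiling by the set $\mathcal{T}_n$ of ribbon $L$ $n$-ominoes.
   Context: Work in the square lattice; a cell is a unit square, identified with the integer coordinates $(\alpha,\beta)\in\mathbb{Z}^2$ of its lower left corner. $\mathcal{T}_n=\{T_1,T_2,T_3,T_4\}$ is the set of ribbon $L$-shaped $n$-ominoes, where, as sets of $n$ cells, $T_1=\{(0,j):0\le j\le n-2\}\cup\{(1,0)\}$, $T_2=\{(1,j):0\le j\le n-2\}\cup\{(0,n-2)\}$, $T_3=\{(i,0):0\le i\le n-2\}\cup\{(0,1)\}$, $T_4=\{(i,1):0\le i\le n-2\}\cup\{(n-2,0)\}$. Only translates of the tiles by integer vectors are allowed. The $L$ $n$-omino is $T_3$. The $k$-inflated copy of a set of cells $P$ is the set of cells $\{(k\alpha+i,k\beta+j):(\alpha,\beta)\in P,\ 0\le i,j\le k-1\}$, i.e. each cell is replaced by a $k\times k$ square. A signed tiling of a region $R$ (a set of cells) by $\mathcal{T}_n$ is a finite collection of translates of tiles of $\mathcal{T}_n$ (repetitions allowed), each with a weight $+1$ or $-1$, such that for every cell in $R$ the sum of the weights of the tiles covering it is $1$, and for every cell outside $R$ this sum is $0$. *)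

(* Defs.v *)
From mathcomp Require Import all_boot all_order all_algebra.
From mathcomp Require Import finmap.
Set Implicit Arguments.
Unset Strict Implicit.
Unset Printing Implicit Defensive.
Import Order.TTheory GRing.Theory Num.Theory.
Local Open Scope fset_scope.
Local Open Scope ring_scope.

(* A cell is identified with the coordinates of its lower left corner. *)
Notation cell := (int * int)%type.

(* For n >= 2, j in iota 0 n.-1 means 0 <= j <= n - 2. *)
Definition T1 (n : nat) : {fset cell} :=
  [fset (0, j%:Z) | j in iota 0 n.-1] `|` [fset (1, 0)].

Definition T2 (n : nat) : {fset cell} :=
  [fset (1, j%:Z) | j in iota 0 n.-1] `|` [fset (0, n%:Z - 2)].

Definition T3 (n : nat) : {fset cell} :=
  [fset (i%:Z, 0) | i in iota 0 n.-1] `|` [fset (0, 1)].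

Definition T4 (n : nat) : {fset cell} :=
  [fset (i%:Z, 1) | i in iota 0 n.-1] `|` [fset (n%:Z - 2, 0)].

Definition ribbon_L (n : nat) : {fset {fset cell}} :=
  [fset T1 n; T2 n; T3 n; T4 n].

Definition L_omino (n : nat) : {fset cell} := T3 n.

Definition inflate (k : nat) (P : {fset cell}) : {fset cell} :=
  [fset (k%:Z * c.1 + (ij.1 : 'I_k)%:Z, k%:Z * c.2 + (ij.2 : 'I_k)%:Z)
     | c in P, ij in {: 'I_k * 'I_k}].

Definition translate (v : cell) (P : {fset cell}) : {fset cell} :=
  [fset c + v | c in P].

(* A translate of a tile with a sign; the weight is -1 when [negative] holds. *)
Definition signed_tile : Type := ({fset cell} * cell * bool)%type.
Definition tile (p : signed_tile) : {fset cell} := p.1.1.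
Definition shift (p : signed_tile) : cell := p.1.2.
Definition negative (p : signed_tile) : bool := p.2.
Definition weight (p : signed_tile) : int := if negative p then -1 else 1.

Definition multiplicity (s : seq signed_tile) (c : cell) : int :=
  \sum_(p <- s | c \in translate (shift p) (tile p)) weight p.

Definition signed_tiling (T : {fset {fset cell}}) (R : {fset cell})
    (s : seq signed_tile) : Prop :=
  all (fun p => tile p \in T) s /\
  (forall c : cell, multiplicity s c = if c \in R then 1 else 0).

(* Main.v *)
Require Import Defs.
From mathcomp Require Import all_boot all_order all_algebra.
From mathcomp Require Import finmap.
From mathcomp Require Import ring zify.

(** Encode a finite set of cells by the polynomial that sums [x^a y^b] over its
    cells [(a, b)]; a signed tiling is then a membership in the ideal [I] of
    [Z[x, y]] generated by the polynomials of the four tiles.  Write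
    [[m]_z = 1 + z + ... + z^(m-1)].  Modulo [T1] and [T2] one gets
    [(x + 1) (x y - 1) = 0], and symmetrically [(y + 1) (x y - 1) = 0] modulo
    [T3] and [T4].  As [n - 1] is even, [y + 1] divides [[n-1]_y], which is [-x]
    modulo [T1]; hence [x (x y - 1)] and then [x y - 1] lie in [I], and so does
    [[n]_y].  Since [x] is now the inverse of [y], the inflated L is, up to a
    unit, a multiple of [[n]_(y^k) [k]_y = [n k]_y = [n]_y [k]_(y^n)]. *)

Set Implicit Arguments.
Unset Strict Implicit.
Unset Printing Implicit Defensive.
Import GRing.Theory Num.Theory.
Local Open Scope fset_scope.
Local Open Scope ring_scope.

(** * Geometric sums *)

Definition geom (R : pzRingType) (m : nat) (z : R) : R := \sum_(i < m) z ^+ i.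

(** Each exponent below [a * b] is uniquely [b * i + j] with [i < a] and [j < b]. *)
Lemma geomM (R : pzRingType) (a b : nat) (z : R) :
  geom a (z ^+ b) * geom b z = geom (a * b) z.
Proof.
rewrite /geom; elim: a => [|a IHa]; first by rewrite mul0n !big_ord0 mul0r.
rewrite big_ord_recr /= mulrDl IHa mulSnr big_split_ord /=; congr (_ + _).
rewrite mulr_sumr; apply: eq_bigr => i _.
by rewrite -exprM -exprD mulnC.
Qed.

Lemma geomS (R : pzRingType) (m : nat) (z : R) : geom m.+1 z = 1 + z * geom m z.
Proof.
rewrite /geom big_ord_recl expr0 mulr_sumr; congr (_ + _).
by apply: eq_bigr => i _; rewrite exprS.
Qed.

Lemma geomSr (R : pzRingType) (m : nat) (z : R) : geom m.+1 z = geom m z + z ^+ m.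
Proof. by rewrite /geom big_ord_recr. Qed.

(** * Ideal computations in a commutative ring *)

Record ideal (R : comPzRingType) (I : R -> Prop) : Prop := Ideal {
  ideal0 : I 0;
  idealD : forall a b, I a -> I b -> I (a + b);
  idealM : forall a b, I b -> I (a * b) }.

Section RibbonIdeal.
Context (R : comPzRingType) (I : R -> Prop) (idI : ideal I).

Lemma idealB a b : I a -> I b -> I (a - b).
Proof. by move=> Ia Ib; rewrite -mulN1r; apply/(idealD idI Ia)/(idealM idI). Qed.

Lemma ideal_sum (m : nat) (F : 'I_m -> R) :
  (forall i, I (F i)) -> I (\sum_(i < m) F i).
Proof.
move=> IF; apply: (big_ind I) => //; first exact: ideal0.
exact: idealD.
Qed.

(** Eliminate [geom m y]: [x] times the first generator minus the second is [x^2 - y^(m-1)], while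
    [y - 1] times the first telescopes to [y^m - 1 + x (y - 1)]. Adding [y] times the former to the
    latter cancels [y^m]. *)
Lemma ideal_ribbon_pair (m : nat) (x y : R) : (0 < m)%N ->
  I (geom m y + x) -> I (x * geom m y + y ^+ m.-1) -> I ((x + 1) * (x * y - 1)).
Proof.
case: m => // m _ /= I1 I2.
suff -> : (x + 1) * (x * y - 1) =
    y * (x * (geom m.+1 y + x) - (x * geom m.+1 y + y ^+ m))
    + (y - 1) * (geom m.+1 y + x).
  by apply: (idealD idI); apply: (idealM idI) => //; apply: idealB => //;
     apply: (idealM idI).
have H : y * geom m.+1 y = geom m.+1 y + y ^+ m.+1 - 1.
  by rewrite -geomSr (geomS m.+1); ring.
rewrite exprS in H.
rewrite [RHS](_ : _ = y * x * x - y * y ^+ m + y * geom m.+1 y - geom m.+1 y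
                      + y * x - x); last by ring.
by rewrite H; ring.
Qed.

Lemma ideal_ribbon_inverse (m : nat) (x y : R) : (0 < m)%N -> ~~ odd m ->
  I (geom m y + x) -> I (x * geom m y + y ^+ m.-1) ->
  I (geom m x + y) -> I (y * geom m x + x ^+ m.-1) -> I (x * y - 1).
Proof.
move=> m_gt0 m_even I1 I2 I3 I4.
have Ix := ideal_ribbon_pair m_gt0 I1 I2.
have Iy := ideal_ribbon_pair m_gt0 I3 I4.
have Sy : geom m y = geom m./2 (y ^+ 2) * (y + 1).
  rewrite -[y + 1](_ : geom 2 y = _) ?geomM ?muln2 ?even_halfK //.
  by rewrite /geom !big_ord_recl big_ord0 expr0 expr1 addr0 addrC.
(* The bracket equals [x (x y - 1)]: by [Sy] its two terms containing [geom m y] cancel. *)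
suff -> : x * y - 1 = (x + 1) * (x * y - 1)
    - ((x * y - 1) * (geom m y + x) - geom m./2 (y ^+ 2) * ((y + 1) * (y * x - 1))).
  by apply: idealB => //; apply: idealB; apply: (idealM idI).
by rewrite Sy; ring.
Qed.

Lemma ideal_subX1 (z : R) (m : nat) : I (z - 1) -> I (z ^+ m - 1).
Proof.
move=> Iz; elim: m => [|m IHm]; first by rewrite expr0 subrr; apply: ideal0.
have -> : z ^+ m.+1 - 1 = z * (z ^+ m - 1) + (z - 1) by rewrite exprS; ring.
by apply: (idealD idI) => //; apply: (idealM idI).
Qed.

Lemma ideal_inflated_L (m k : nat) (x y : R) : (0 < m)%N ->
  I (x * y - 1) -> I (geom m.+1 y) ->
  I ((geom m (x ^+ k) + y ^+ k) * (geom k x * geom k y)).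
Proof.
case: m => // m _ Ixy Iy; set F := _ * _.
set N := (k * m)%N.
(* As [x ^+ N] inverts [y ^+ N] modulo [I], it suffices to treat [y ^+ N * F]. *)
have -> : F = x ^+ N * (y ^+ N * F) - F * ((x * y) ^+ N - 1).
  by rewrite exprMn; ring.
apply: idealB; last by apply/(idealM idI)/ideal_subX1.
apply: (idealM idI).
(* Multiplying by [y ^+ N] turns [x^(k i)] into [y^(k (m - i))] modulo [I], so the sum in [x^k]
   becomes the reversed sum in [y^k]. *)
have Iflip : I (y ^+ N * geom m.+1 (x ^+ k) - geom m.+1 (y ^+ k)).
  rewrite /geom [X in _ - X](reindex_inj rev_ord_inj) /= mulr_sumr -sumrB.
  apply: ideal_sum => i.
  rewrite subSS /N.
  have le_im : (i <= m)%N by rewrite -ltnS.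
  rewrite -{1}(subnK le_im) mulnDr exprD -!exprM.
  have -> : y ^+ (k * (m - i)) * y ^+ (k * i) * x ^+ (k * i)
            - y ^+ (k * (m - i)) = y ^+ (k * (m - i)) * ((x * y) ^+ (k * i) - 1).
    by rewrite exprMn; ring.
  by apply/(idealM idI)/ideal_subX1.
(* The extra cell contributes [y^N y^k = (y^k)^(m+1)], exactly the next term of the geometric sum in
   [y^k]. *)
have -> : y ^+ N * F =
    geom k x * geom k y * (y ^+ N * geom m.+1 (x ^+ k) - geom m.+1 (y ^+ k))
    + geom k x * (geom m.+2 (y ^+ k) * geom k y).
  rewrite [geom m.+2 _]geomSr -exprM mulnS addnC exprD -/N /F; ring.
apply: (idealD idI); apply: (idealM idI) => //.
by rewrite geomM mulnC -geomM; apply: (idealM idI).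
Qed.

End RibbonIdeal.

(** * Cells and regions as polynomials *)

(* [Z[x, y]] is [{poly {poly int}}], with [x] the outer variable. *)
Notation bipoly := {poly {poly int}}.
Notation Xv := ('X : bipoly).
Notation Yv := ('X%:P : bipoly).

(** The value 0 at cells with a negative coordinate makes this a weight on the whole lattice, so
    that multiplying by a variable is a translation even along the axes. *)
Definition coef2 (p : bipoly) (c : cell) : int :=
  if c is (Posz a, Posz b) then p`_a`_b else 0.

Lemma coef2_0 c : coef2 0 c = 0.
Proof. by case: c => [[a|a] [b|b]] //=; rewrite !coef0. Qed.

Lemma coef2D p q c : coef2 (p + q) c = coef2 p c + coef2 q c.
Proof. by case: c => [[a|a] [b|b]] //=; rewrite !coefD. Qed.

Lemma coef2N p c : coef2 (- p) c = - coef2 p c.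
Proof. by case: c => [[a|a] [b|b]] //=; rewrite ?coefN ?oppr0. Qed.

Lemma coef2_mulX p c : coef2 (Xv * p) c = coef2 p (c - (1, 0)).
Proof.
case: c => [a b].
have -> : (a, b) - (1, 0) = (a - 1, b) :> cell by congr pair; rewrite /= subr0.
case: a b => [[|a]|a] [b|b] //=; rewrite coefXM /= ?coef0 //.
by rewrite subn1.
Qed.

Lemma coef2_mulY p c : coef2 (Yv * p) c = coef2 p (c - (0, 1)).
Proof.
case: c => [a b].
have -> : (a, b) - (0, 1) = (a, b - 1) :> cell by congr pair; rewrite /= subr0.
case: a b => [a|a] [[|b]|b] //=; rewrite coefCM coefXM //=.
by rewrite subn1.
Qed.

(** The absolute values only convert integers to exponents; the encoding is faithful on cells
    satisfying [nonneg_cell]. *)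
Definition monomial (c : cell) : bipoly := Xv ^+ `|c.1|%N * Yv ^+ `|c.2|%N.

Definition nonneg_cell (c : cell) : bool := (0 <= c.1) && (0 <= c.2).

Lemma coef2_monomial c d : nonneg_cell d -> coef2 (monomial d) c = (c == d)%:R.
Proof.
case: d => [[a|a] [b|b]] // _; rewrite /monomial /= -rmorphXn.
case: c => [[a'|a'] [b'|b']] //=; last by rewrite xpair_eqE andbF.
rewrite coefMC coefXn mulr_natl coefMn coefXn xpair_eqE !eqz_nat.
by case: (a' == a); case: (b' == b).
Qed.

Definition set_poly (P : {fset cell}) : bipoly := \sum_(c <- P) monomial c.

Lemma coef2_set_poly (P : {fset cell}) c : all nonneg_cell P ->
  coef2 (set_poly P) c = if c \in P then 1 else 0.
Proof.
move=> /allP P_ge0.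
rewrite /set_poly (big_morph _ (fun p q => coef2D p q c) (coef2_0 c)).
rewrite (eq_big_seq (fun d => (c == d)%:R)); last first.
  by move=> d dP; apply/coef2_monomial/P_ge0.
case: ifP => [cP | /negP cP].
  rewrite (bigD1_seq c) ?fset_uniq //= eqxx big1 ?addr0 // => d.
  by rewrite eq_sym => /negPf ->.
by rewrite big_seq big1 // => d dP; case: eqP dP => // <- /cP.
Qed.

Lemma big_fset_seq (F : cell -> bipoly) (P : {fset cell}) (s : seq cell) :
  uniq s -> s =i P -> \sum_(c <- P) F c = \sum_(c <- s) F c.
Proof.
move=> s_uniq sP; by apply: perm_big; apply: uniq_perm.
Qed.

(** Common shape of the four tiles: a segment of cells plus one further cell. *)
Lemma big_line (F : cell -> bipoly) (m : nat) (f : nat -> cell) (c : cell) :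
    injective f -> (forall j, f j != c) ->
  \sum_(d <- [fset f j | j in iota 0 m] `|` [fset c]) F d =
  \sum_(j < m) F (f j) + F c.
Proof.
move=> f_inj fc.
rewrite (@big_fset_seq _ _ (rcons (map f (iota 0 m)) c)).
- by rewrite big_rcons /= big_map -(big_mkord xpredT (F \o f)) /index_iota subn0.
- rewrite rcons_uniq map_inj_uniq ?iota_uniq // andbT.
  by apply/mapP => -[j _ /eqP]; rewrite eq_sym (negPf (fc j)).
- move=> d; rewrite mem_rcons !inE orbC; congr (_ || _).
  by apply/mapP/imfsetP => -[j /= jm ->]; exists j.
Qed.

Lemma set_poly_T1 n : set_poly (T1 n) = geom n.-1 Yv + Xv.
Proof.
rewrite /set_poly (@big_line _ n.-1 (fun j => (0, j%:Z)) (1, 0)) //; last by move=> i j [].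
rewrite /monomial /= expr1 expr0 mulr1; congr (_ + _).
by apply: eq_bigr => j _; rewrite mul1r.
Qed.

Lemma set_poly_T2 n : (1 < n)%N ->
  set_poly (T2 n) = Xv * geom n.-1 Yv + Yv ^+ n.-2.
Proof.
case: n => [|[|n]] // _.
rewrite /set_poly (@big_line _ n.+1 (fun j => (1, j%:Z)) (0, n.+2%:Z - 2)) //; last first.
  by move=> i j [].
have -> : n.+2%:Z - 2 = n%:Z by lia.
rewrite /monomial /= expr0 mul1r /geom mulr_sumr; congr (_ + _).
Qed.

Lemma big_T3 (F : cell -> bipoly) n :
  \sum_(c <- T3 n) F c = \sum_(j < n.-1) F (j%:Z, 0) + F (0, 1).
Proof.
rewrite (@big_line _ _ (fun j => (j%:Z, 0))) //; first by move=> i j [].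
by move=> j; rewrite xpair_eqE andbF.
Qed.

Lemma set_poly_T3 n : set_poly (T3 n) = geom n.-1 Xv + Yv.
Proof.
rewrite /set_poly big_T3 /monomial /= expr1 expr0 mul1r; congr (_ + _).
by apply: eq_bigr => j _; rewrite mulr1.
Qed.

Lemma set_poly_T4 n : (1 < n)%N ->
  set_poly (T4 n) = Yv * geom n.-1 Xv + Xv ^+ n.-2.
Proof.
case: n => [|[|n]] // _.
rewrite /set_poly (@big_line _ n.+1 (fun j => (j%:Z, 1)) (n.+2%:Z - 2, 0)) //; first last.
- by move=> j; rewrite xpair_eqE andbF.
- by move=> i j [].
have -> : n.+2%:Z - 2 = n%:Z by lia.
rewrite /monomial /= expr0 mulr1 /geom mulr_sumr; congr (_ + _).
by apply: eq_bigr => j _; rewrite mulrC.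
Qed.

Lemma ribbon_L_nonneg n P : (1 < n)%N -> P \in ribbon_L n -> all nonneg_cell P.
Proof.
move=> n_gt1; rewrite !inE -!orbA => /or4P[] /eqP -> ; apply/allP => c;
  rewrite !inE => /orP[/imfsetP[j _ ->] | /eqP ->] //=; rewrite /nonneg_cell /=; lia.
Qed.

(** * Inflation *)

Lemma inflate_nonneg k (P : {fset cell}) : all nonneg_cell P -> all nonneg_cell (inflate k P).
Proof.
move=> /allP P_ge0; apply/allP => c /imfset2P[d /P_ge0 /andP[d1 d2] [ij _ ->]].
by rewrite /nonneg_cell /= !addr_ge0 ?mulr_ge0.
Qed.

(** Uniqueness of Euclidean division by [k]; it ensures that the squares replacing distinct cells do
    not overlap. *)
Lemma inflate_digit (k : nat) (a b : int) (i j : 'I_k) :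
  k%:Z * a + i%:Z = k%:Z * b + j%:Z -> a = b /\ i = j.
Proof.
move=> e.
(* The ordinal [i] witnesses that ['I_k] is inhabited. *)
have k_neq0 : k%:Z != 0 by case: k i {j e} => [[]|].
have ab : a = b.
  have /(congr1 (fun z => (z %/ k%:Z)%Z)) := e.
  by rewrite ![k%:Z * _]mulrC !divzMDl // !divz_small ?addr0 //;
     rewrite lez_nat ltz_nat /= ltn_ord.
split=> //; apply/val_inj; move: e; rewrite ab => /addrI []; exact.
Qed.

(** The corner of each square gives the monomial of its cell in [x^k] and [y^k], and every square
    contributes the same factor [geom k Xv * geom k Yv]. *)
Lemma set_poly_inflate k (P : {fset cell}) : all nonneg_cell P ->
  set_poly (inflate k P) =
  (\sum_(c <- P) (Xv ^+ k) ^+ `|c.1|%N * (Yv ^+ k) ^+ `|c.2|%N)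
  * (geom k Xv * geom k Yv).
Proof.
move=> /allP P_ge0.
pose f (c : cell) (ij : 'I_k * 'I_k) : cell :=
  (k%:Z * c.1 + ij.1%:Z, k%:Z * c.2 + ij.2%:Z).
rewrite /set_poly (@big_fset_seq _ _ [seq f c ij | c <- P, ij <- enum {: 'I_k * 'I_k}]).
- rewrite big_allpairs_dep mulr_suml; apply: eq_big_seq => -[c1 c2] /P_ge0.
  case: c1 c2 => [a|a] [b|b] // _ /=.
  rewrite big_enum /= -(pair_bigA _ (fun i j => monomial (f (Posz a, Posz b) (i, j)))) /=.
  rewrite /geom big_distrlr mulr_sumr; apply: eq_bigr => i _.
  rewrite mulr_sumr; apply: eq_bigr => j _.
  have -> : monomial (f (Posz a, Posz b) (i, j)) =
    Xv ^+ (k * a + i) * Yv ^+ (k * b + j) by [].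
  by rewrite !exprD !exprM /=; ring.
- apply: (@allpairs_uniq _ _ _ f); rewrite ?fset_uniq ?enum_uniq //.
  move=> [[c1 c2] [i j]] [[d1 d2] [i' j']] _ _ [/= e1 e2].
  by have [-> ->] := inflate_digit e1; have [-> ->] := inflate_digit e2.
- move=> c; apply/allpairsP/imfset2P => /=.
    by move=> [[d ij] /= [dP _ ->]]; exists d => //; exists ij.
  by move=> [d dP [ij _ ->]]; exists (d, ij); rewrite mem_enum.
Qed.

(** * Signed tilings form an ideal *)

Lemma mem_translate v P c : (c \in translate v P) = (c - v \in P).
Proof.
apply/imfsetP/idP => [[d dP ->] | cP]; first by rewrite addrK.
by exists (c - v); rewrite ?subrK.
Qed.

(** Arbitrary integer weights replace the 0-1 weights of a region, which are not closed under
    sums. *)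
Definition signed_tileable (T : {fset {fset cell}}) (p : bipoly) : Prop :=
  exists s : seq signed_tile,
    all (fun t => tile t \in T) s /\ (forall c, multiplicity s c = coef2 p c).

Definition map_shift (v : cell) (s : seq signed_tile) : seq signed_tile :=
  [seq (tile t, shift t + v, negative t) | t <- s].

Lemma multiplicity_shift v s c :
  multiplicity (map_shift v s) c = multiplicity s (c - v).
Proof.
rewrite /multiplicity big_map; apply: eq_bigl => t.
by rewrite !mem_translate /= opprD addrA addrAC.
Qed.

Section Tileable.
Context (T : {fset {fset cell}}).

Lemma tileable0 : signed_tileable T 0.
Proof. by exists [::]; split=> // c; rewrite coef2_0 /multiplicity big_nil. Qed.

Lemma tileableD p q :
  signed_tileable T p -> signed_tileable T q -> signed_tileable T (p + q).
Proof.
move=> [s [sT sp]] [r [rT rq]]; exists (s ++ r); split; first by rewrite all_cat sT.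
by move=> c; rewrite coef2D -sp -rq /multiplicity big_cat.
Qed.

Lemma tileableN p : signed_tileable T p -> signed_tileable T (- p).
Proof.
move=> [s [sT sp]]; exists [seq (tile t, shift t, ~~ negative t) | t <- s].
split; first by rewrite all_map.
move=> c; rewrite coef2N -sp /multiplicity big_map -sumrN; apply: eq_bigr => t _.
by rewrite /weight /=; case: (negative t); rewrite ?opprK.
Qed.

Lemma tileableX p : signed_tileable T p -> signed_tileable T (Xv * p).
Proof.
move=> [s [sT sp]]; exists (map_shift (1, 0) s); split; first by rewrite all_map.
by move=> c; rewrite multiplicity_shift sp coef2_mulX.
Qed.

Lemma tileableY p : signed_tileable T p -> signed_tileable T (Yv * p).
Proof.
move=> [s [sT sp]]; exists (map_shift (0, 1) s); split; first by rewrite all_map.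
by move=> c; rewrite multiplicity_shift sp coef2_mulY.
Qed.

(** A multiplier is built from integers by sums and products with the variables: induct on it in
    [x], then on its coefficients in [y], then on the integers, using translation, union and sign
    change of tilings. *)
Lemma tileable_ideal : ideal (signed_tileable T).
Proof.
split; [exact: tileable0 | exact: tileableD | move=> a p Tp].
elim/poly_ind: a => [|a c IHa]; first by rewrite mul0r; apply: tileable0.
rewrite mulrDl [a * 'X]mulrC -mulrA.
apply: tileableD; first exact: tileableX.
elim/poly_ind: c => [|c z IHc]; first by rewrite mul0r; apply: tileable0.
rewrite polyCD polyCM mulrDl [c%:P * _]mulrC -mulrA.
apply: tileableD; first exact: tileableY.
rewrite -[z]intz !rmorph_int mulrzl.
elim/int_ind: z => [|m IHm|m IHm]; first by rewrite mulr0z; apply: tileable0.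
  by rewrite intS mulrzDr mulr1z; apply: tileableD.
by rewrite intS opprD mulrzDr mulrN1z; apply: tileableD => //; apply: tileableN.
Qed.

Lemma tileable_tile P : P \in T -> all nonneg_cell P -> signed_tileable T (set_poly P).
Proof.
move=> PT P_ge0; exists [:: (P, 0, false)]; rewrite /= PT; split=> // c.
rewrite coef2_set_poly // /multiplicity big_cons big_nil mem_translate subr0 /=.
by rewrite addr0.
Qed.

End Tileable.

Local Close Scope ring_scope.
Local Close Scope fset_scope.

(** * Application to the ribbon tiles *)

Theorem proposition5 (n k : nat) (hn : 5 <= n) (n_odd : odd n) (hk : 1 <= k) :
  exists s : seq signed_tile,
    signed_tiling (ribbon_L n) (inflate k (L_omino n)) s.
Proof.
have n_gt1 : 1 < n by apply: leq_trans hn.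
have m_gt0 : 0 < n.-1 by rewrite -subn1 subn_gt0.
have m_even : ~~ odd n.-1 by case: (n) n_odd.
have idI := tileable_ideal (ribbon_L n).
have IT P : P \in ribbon_L n -> signed_tileable (ribbon_L n) (set_poly P).
  by move=> PT; apply: tileable_tile => //; apply: ribbon_L_nonneg PT.
have T1_in : T1 n \in ribbon_L n by rewrite !inE eqxx.
have T2_in : T2 n \in ribbon_L n by rewrite !inE eqxx !orbT.
have T3_in : T3 n \in ribbon_L n by rewrite !inE eqxx !orbT.
have T4_in : T4 n \in ribbon_L n by rewrite !inE eqxx !orbT.
have T3_ge0 : all nonneg_cell (T3 n) by apply: ribbon_L_nonneg T3_in.
have I1 := IT _ T1_in; rewrite set_poly_T1 in I1.
have I2 := IT _ T2_in; rewrite set_poly_T2 // in I2.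
have I3 := IT _ T3_in; rewrite set_poly_T3 in I3.
have I4 := IT _ T4_in; rewrite set_poly_T4 // in I4.
have Ixy := ideal_ribbon_inverse idI m_gt0 m_even I1 I2 I3 I4.
(* Since [geom n.-1 Yv] is [-x] modulo [T1], the sum [1 + y * geom n.-1 Yv] is [1 - x y], which
   vanishes modulo the ideal. *)
have Iy : signed_tileable (ribbon_L n) (geom n.-1.+1 Yv).
  have -> : geom n.-1.+1 Yv = (Yv * (geom n.-1 Yv + Xv) - (Xv * Yv - 1))%R.
    by rewrite geomS; ring.
  by apply: (idealB idI) => //; apply: (idealM idI).
have [s [sT sp]] := ideal_inflated_L idI k m_gt0 Ixy Iy.
(* The indicator of the inflated region is read as the coefficients of its polynomial, which is then
   matched with the product in [ideal_inflated_L]. *)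
exists s; split=> // c; rewrite sp -coef2_set_poly; last exact: inflate_nonneg.
rewrite set_poly_inflate // big_T3 /= !expr0 !expr1 mul1r /geom.
by congr (coef2 ((_ + _) * _) c); apply: eq_bigr => i _; rewrite mulr1.
Qed.
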